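(* Let $G$ be a finite simple unmixed graph such that $I_c(G)$ is not linearly presented. Then there are distinct minimal vertex covers $C_1,C_2$ of $G$ such that the induced subgraph $G'=G[C_1\triangle C_2]$ is an unmixed bipartite graph without isolated vertices which is not Cohen–Macaulay.
   Context: $G$ has vertices $t_1,\dots,t_s$, $S=K[t_1,\dots,t_s]$, $K$ a field. $G$ is unmixed if all minimal vertex covers (inclusion-minimal vertex sets meeting every edge) have equal size. $I_c(G)$ is generated by $\prod_{t_i\in C}t_i$ over minimal vertex covers $C$; a monomial ideal minimally generated by $u_1,\dots,u_r$ is linearly presented if all $u_i$ have the same degree and the kernel of $S^r\to S$, $e_i\mapsto u_i$, is generated by vectors with linear-form entries. $C_1\triangle C_2$ is the symmetric difference and $G[L]$ is the subgraph induced on $L$. A graph $H$ is Cohen–Macaulay if $R/I(H)$ is Cohen–Macaulay, where $R$ is the polynomial ring on $V(H)$ and $I(H)$ is generated by the products $tt'$ over edges $\{t,t'\}$ of $H$. *)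

(* Defs.v *)
From HB Require Import structures.
From mathcomp Require Import all_boot all_order all_algebra.
From mathcomp Require Import mpoly.
Set Implicit Arguments. Unset Strict Implicit. Unset Printing Implicit Defensive.
Import Order.TTheory GRing.Theory.
Local Open Scope ring_scope.

(* A finite simple graph: vertex type T (finType), edge relation e : rel T,
   assumed symmetric and irreflexive (as hypotheses of the theorem). *)

Section Graphs.
Variable T : finType.
Variable e : rel T.

Definition vcover (C : {set T}) : bool :=
  [forall x, forall y, e x y ==> (x \in C) || (y \in C)].

Definition minvcover (C : {set T}) : bool := minset vcover C.

Definition unmixed : Prop :=
  forall C D : {set T}, minvcover C -> minvcover D -> #|C| = #|D|.

Definition bipartite : Prop :=
  exists col : T -> bool, forall x y, e x y -> col x != col y.

Definition no_isolated : Prop := forall x, exists y, e x y.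

End Graphs.

Definition induced (T : finType) (e : rel T) (L : {set T}) :
  rel {x : T | x \in L} := fun x y => e (val x) (val y).
Arguments induced {T} e L _ _.

Section Algebra.
Variable K : fieldType.
Variable T : finType.
Local Notation n := #|T|.
Local Notation S := {mpoly K[n]}.

Definition var (x : T) : S := 'X_(enum_rank x).

Definition in_ideal (gs : seq S) (p : S) : Prop :=
  exists cs : seq S, p = \sum_(i < size gs) cs`_i * gs`_i.

Definition edge_gens (e : rel T) : seq S :=
  flatten [seq [seq var x * var y | y <- enum T & e x y] | x <- enum T].

Definition nzd_mod (gs : seq S) (f : S) : Prop :=
  forall g, in_ideal gs (f * g) -> in_ideal gs g.

(* fs is an (S/(gs))-regular sequence contained in the homogeneous maximal
   ideal m = (t_x : x in T) (i.e. with zero constant terms) *)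
Definition regular_seq (gs fs : seq S) : Prop :=
  (forall f, f \in fs -> f@_0%MM = 0) /\
  (forall k, (k < size fs)%N -> nzd_mod (gs ++ take k fs) (nth 0 fs k)) /\
  ~ in_ideal (gs ++ fs) 1.

Definition depth_is (gs : seq S) (d : nat) : Prop :=
  (exists fs, size fs = d /\ regular_seq gs fs) /\
  (forall fs, regular_seq gs fs -> (size fs <= d)%N).

Definition is_ideal (P : S -> Prop) : Prop :=
  P 0 /\ (forall a b, P a -> P b -> P (a + b)) /\ (forall r a, P a -> P (r * a)).

Definition is_prime (P : S -> Prop) : Prop :=
  is_ideal P /\ ~ P 1 /\ (forall a b, P (a * b) -> P a \/ P b).

Definition prime_chain (gs : seq S) (k : nat) : Prop :=
  exists Ps : nat -> S -> Prop,
    (forall i, (i <= k)%N -> is_prime (Ps i) /\ forall p, in_ideal gs p -> Ps i p) /\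
    (forall i, (i < k)%N ->
       (forall p, Ps i p -> Ps i.+1 p) /\ exists p, Ps i.+1 p /\ ~ Ps i p).

Definition dim_is (gs : seq S) (d : nat) : Prop :=
  prime_chain gs d /\ forall k, prime_chain gs k -> (k <= d)%N.

Definition CM_quot (gs : seq S) : Prop := exists d, depth_is gs d /\ dim_is gs d.

Definition CM_graph (e : rel T) : Prop := CM_quot (edge_gens e).

Definition cover_mon (C : {set T}) : S := \prod_(x in C) var x.

(* I_c(G) is linearly presented, w.r.t. its minimal monomial generators
   u_C, C ranging over the minimal vertex covers of G. *)
Definition lin_presented (e : rel T) : Prop :=
  let I := {C : {set T} | minvcover e C} in
  let u := fun C : I => cover_mon (val C) in
  let syz := fun f : I -> S => \sum_(C : I) f C * u C = 0 in
  (exists d, forall C : I, u C \is d.-homog) /\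
  exists m (s : 'I_m -> I -> S),
    (forall j, syz (s j)) /\ (forall j C, s j C \is 1.-homog) /\
    forall f : I -> S, syz f ->
      exists a : 'I_m -> S, forall C, f C = \sum_(j < m) a j * s j C.

End Algebra.

(* Main.v *)
Require Import Defs.
From HB Require Import structures.
From mathcomp Require Import all_boot all_order all_algebra.
From mathcomp Require Import mpoly.
Set Implicit Arguments. Unset Strict Implicit. Unset Printing Implicit Defensive.
Import GRing.Theory.
Local Open Scope ring_scope.

(** If any two minimal covers [C1], [C2] can be joined by exchanging one vertex
at a time through minimal covers contained in [C1 :|: C2], then the relations
between covers that differ by one exchange generate all syzygies of [I_c(G)], so
[I_c(G)] is linearly presented.  Otherwise take a pair [C1], [C2] that cannot be
joined and has [#|C1 :|: C2|] minimal.  By minimality every vertex of [C1 :\: C2]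
is adjacent to every vertex of [C2 :\: C1], so the induced subgraph on the
symmetric difference is the complete bipartite graph [K_{a,a}], with [a >= 2].
It is unmixed; its edge ideal is the intersection of two linear primes whose sum
is the maximal ideal, so the quotient has depth 1 but dimension at least 2. *)

(** * Finitely generated ideals and congruences modulo them *)

(** Coefficient functions on indices can be added and scaled pointwise, with no matching of list
    lengths. *)
Lemma in_idealP (K : fieldType) (T : finType) (gs : seq {mpoly K[#|T|]}) p :
  in_ideal gs p <-> exists c : nat -> {mpoly K[#|T|]},
    p = \sum_(i < size gs) c i * gs`_i.
Proof.
split=> [[cs ->]|[c ->]]; first by exists (fun i => cs`_i).
exists (mkseq c (size gs)); apply: eq_bigr => i _.
by rewrite nth_mkseq.
Qed.

Lemma in_ideal_ideal (K : fieldType) (T : finType)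
  (gs : seq {mpoly K[#|T|]}) : is_ideal (in_ideal gs).
Proof.
split; [|split].
- by apply/in_idealP; exists (fun=> 0); rewrite big1 // => i _; rewrite mul0r.
- move=> a b /in_idealP [c ->] /in_idealP [d ->]; apply/in_idealP.
  exists (fun i => c i + d i); rewrite -big_split; apply: eq_bigr => i _.
  by rewrite mulrDl.
- move=> r a /in_idealP [c ->]; apply/in_idealP.
  exists (fun i => r * c i); rewrite mulr_sumr; apply: eq_bigr => i _.
  by rewrite mulrA.
Qed.

Lemma in_ideal_mem (K : fieldType) (T : finType)
  (gs : seq {mpoly K[#|T|]}) g : g \in gs -> in_ideal gs g.
Proof.
move=> gin; apply/in_idealP; exists (fun i => (i == index g gs)%:R).
have lt_i : (index g gs < size gs)%N by rewrite index_mem.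
rewrite (bigD1 (Ordinal lt_i)) //= eqxx mul1r nth_index // big1 ?addr0 //.
by move=> i; rewrite -val_eqE /= => /negbTE ->; rewrite mul0r.
Qed.

Lemma in_ideal_min (K : fieldType) (T : finType) (gs : seq {mpoly K[#|T|]})
  (P : {mpoly K[#|T|]} -> Prop) p :
  is_ideal P -> (forall g, g \in gs -> P g) -> in_ideal gs p -> P p.
Proof.
case=> P0 [PD PM] Pg /in_idealP [c ->].
apply: (big_ind P) => // i _; apply: PM; apply: Pg; exact: mem_nth.
Qed.

Lemma rmorphism_ker_ideal (K : fieldType) (T : finType) (R : nzRingType)
  (s : {rmorphism {mpoly K[#|T|]} -> R}) : is_ideal (fun p => s p = 0).
Proof.
split; [exact: rmorph0 | split].
- by move=> a b sa sb; rewrite rmorphD sa sb addr0.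
- by move=> r a sa; rewrite rmorphM sa mulr0.
Qed.

(** The polynomials congruent to their image are closed under sums, and under products because
    [p * q - s (p * q)] equals [p * (q - s q) + s q * (p - s p)]. They contain the constants and the
    variables, hence everything. *)
Lemma rmorphism_mod_ideal (K : fieldType) (T : finType)
  (s : {rmorphism {mpoly K[#|T|]} -> {mpoly K[#|T|]}})
  (P : {mpoly K[#|T|]} -> Prop) :
  is_ideal P -> (forall c, s c%:MP = c%:MP) ->
  (forall x : T, P (var K x - s (var K x))) -> forall p, P (p - s p).
Proof.
case=> P0 [PD PM] sC sX.
have QD p q : P (p - s p) -> P (q - s q) -> P (p + q - s (p + q)).
  by move=> Pp Pq; rewrite rmorphD opprD addrACA; apply: PD.
have QM p q : P (p - s p) -> P (q - s q) -> P (p * q - s (p * q)).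
  move=> Pp Pq.
  have -> : p * q - s (p * q) = p * (q - s q) + s q * (p - s p).
    rewrite rmorphM !mulrBr addrA [s q * p]mulrC subrK.
    by rewrite [s q * _]mulrC.
  by apply: PD; apply: PM.
have QC c : P (c%:MP - s c%:MP) by rewrite sC subrr.
move=> p; rewrite [p]mpolyE.
apply: (big_ind (fun p => P (p - s p))) => //.
  by rewrite rmorph0 subr0.
move=> m _; rewrite -mul_mpolyC; apply: (QM) => //.
rewrite mpolyXE_id; apply: (big_ind (fun p => P (p - s p))) => //.
  by rewrite rmorph1 subrr.
move=> i _; elim: (m i) => [|k IH]; first by rewrite expr0 rmorph1 subrr.
by rewrite exprS; apply: (QM) => //; rewrite -[i]enum_valK; apply: sX.
Qed.

Lemma var_ideal (K : fieldType) (T : finType) (p : {mpoly K[#|T|]}) :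
  p@_0%MM = 0 -> in_ideal [seq var K x | x <- enum T] p.
Proof.
(* [s] is evaluation at the origin: it sends every variable to 0 and, by hypothesis, [p] as well. *)
move=> p0; pose s : {rmorphism {mpoly K[#|T|]} -> {mpoly K[#|T|]}} :=
  @mpolyC #|T| K \o mcoeff 0%MM.
have -> : p = p - s p by rewrite /s /= p0 mpolyC0 subr0.
apply: rmorphism_mod_ideal; first exact: in_ideal_ideal.
  by move=> c; rewrite /s /= mcoeffC eqxx mulr1.
move=> x; rewrite /s /= /var mcoeffX mnm1_eq0 mpolyC0 subr0.
by apply: in_ideal_mem; apply: (map_f (@var K T)); rewrite mem_enum.
Qed.

(** * Primes generated by sets of variables *)

(** The quotient by the variables in [D], realised as an endomorphism of the same polynomial ring.
    Its kernel is the prime generated by these variables, so membership becomes an equation in a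
    domain. *)
Definition kill (K : fieldType) (T : finType) (D : {set T}) :
    {mpoly K[#|T|]} -> {mpoly K[#|T|]} :=
  comp_mpoly [tuple if enum_val i \in D then 0 else 'X_i | i < #|T|].

HB.instance Definition _ (K : fieldType) (T : finType) (D : {set T}) :=
  GRing.RMorphism.on (@kill K T D).

Lemma kill_var (K : fieldType) (T : finType) (D : {set T}) x :
  kill D (var K x) = if x \in D then 0 else var K x.
Proof. by rewrite /kill /var comp_mpolyXU -tnth_nth tnth_mktuple enum_rankK. Qed.

Lemma killC (K : fieldType) (T : finType) (D : {set T}) (c : K) :
  kill (T := T) D c%:MP = c%:MP.
Proof. exact: comp_mpolyC. Qed.

Lemma kill_ker_ideal (K : fieldType) (T : finType) (D : {set T}) :
  is_ideal (fun p : {mpoly K[#|T|]} => kill D p = 0).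
Proof. exact: rmorphism_ker_ideal. Qed.

Lemma var_neq0 (K : fieldType) (T : finType) (x : T) : var K x != 0.
Proof.
apply/eqP=> /mpolyP /(_ U_(enum_rank x)%MM).
by rewrite mcoeffXU mcoeff0 eqxx => /eqP; rewrite oner_eq0.
Qed.

Lemma kill_mod_ideal (K : fieldType) (T : finType) (D : {set T})
    (P : {mpoly K[#|T|]} -> Prop) p :
  is_ideal P -> (forall x, x \in D -> P (var K x)) -> P (p - kill D p).
Proof.
move=> idP PX; pose s : {rmorphism _ -> _} := @kill K T D.
apply: (@rmorphism_mod_ideal _ _ s) => // [c|x]; first exact: killC.
rewrite [s _]kill_var; case: ifP => xD; first by rewrite subr0; apply: PX.
by rewrite subrr; case: idP.
Qed.

Lemma kill_eq0 (K : fieldType) (T : finType) (D : {set T})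
    (p : {mpoly K[#|T|]}) :
  kill D p = 0 <-> in_ideal [seq var K x | x <- enum D] p.
Proof.
split=> [p0|].
  have -> : p = p - kill D p by rewrite p0 subr0.
  apply: kill_mod_ideal => [|x xD]; first exact: in_ideal_ideal.
  by apply: in_ideal_mem; apply: (map_f (@var K T)); rewrite mem_enum.
move=> inI; pattern p; apply: in_ideal_min inI; first exact: kill_ker_ideal.
by move=> g /mapP [x]; rewrite mem_enum => xD ->; rewrite kill_var xD.
Qed.

Lemma kill_sub_eq0 (K : fieldType) (T : finType) (D E : {set T})
    (p : {mpoly K[#|T|]}) : D \subset E -> kill D p = 0 -> kill E p = 0.
Proof.
move=> /subsetP sDE p0; have -> : p = p - kill D p by rewrite p0 subr0.
apply: (kill_mod_ideal (P := fun p => kill E p = 0)) => [|x xD].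
  exact: kill_ker_ideal.
by rewrite kill_var sDE.
Qed.

Lemma kill_eq0_coef0 (K : fieldType) (T : finType) (D : {set T})
    (p : {mpoly K[#|T|]}) : kill D p = 0 -> p@_0%MM = 0.
Proof.
move=> /kill_eq0 inI; pattern p; apply: in_ideal_min inI; first exact: rmorphism_ker_ideal.
by move=> g /mapP [x _ ->]; rewrite /var mcoeffX mnm1_eq0.
Qed.

Lemma kill_prime (K : fieldType) (T : finType) (D : {set T}) :
  is_prime (fun p : {mpoly K[#|T|]} => kill D p = 0).
Proof.
split; first exact: kill_ker_ideal.
split; first by rewrite rmorph1 => /eqP; rewrite oner_eq0.
by move=> a b; rewrite rmorphM => /eqP; rewrite mulf_eq0 => /orP [] /eqP; auto.
Qed.

(** * Depth and dimension for complete bipartite graphs *)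

Lemma mem_edge_gens (K : fieldType) (T : finType) (e : rel T) g :
  g \in edge_gens K e <-> exists x y, e x y /\ g = var K x * var K y.
Proof.
split=> [/flatten_mapP [x _ /mapP [y]]|[x [y [exy ->]]]].
  by rewrite mem_filter => /andP [exy _] ->; exists x, y.
apply/flatten_mapP; exists x; first by rewrite mem_enum.
by apply: map_f; rewrite mem_filter exy mem_enum.
Qed.

Section CompleteBipartite.
Variables (K : fieldType) (T : finType) (e : rel T).
Implicit Types (A : {set T}) (p q f : {mpoly K[#|T|]}).
Let I := in_ideal (edge_gens K e).

(** The hypothesis on [e] makes it complete bipartite with sides [A] and [~: A]. Every edge has an
    end in [A], so each generator contains a killed variable. *)
Lemma kill_edge_ideal A p : (forall x y, e x y = (x \in A) (+) (y \in A)) ->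
  I p -> kill A p = 0.
Proof.
move=> eA inI; pattern p; apply: in_ideal_min inI; first exact: kill_ker_ideal.
move=> g /mem_edge_gens [x [y [+ ->]]].
rewrite eA rmorphM /= !kill_var.
by case: ifP; case: ifP => //; rewrite ?mul0r ?mulr0.
Qed.

(** A variable from [A] times one from [~: A] is an edge generator; this extends to the two ideals
    by linearity, first in [p] and then in [q]. *)
Lemma edge_ideal_mul A p q : (forall x y, e x y = (x \in A) (+) (y \in A)) ->
  kill A p = 0 -> kill (~: A) q = 0 -> I (p * q).
Proof.
move=> eA /kill_eq0 pA /kill_eq0 qB; have [I0 [ID IM]] := in_ideal_ideal (edge_gens K e).
pattern p; apply: in_ideal_min pA.
  split; [by rewrite mul0r | split] => [a b Ha Hb|r a Ha].
    by rewrite mulrDl; apply: ID.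
  by rewrite -mulrA; apply: IM.
move=> g /mapP [x]; rewrite mem_enum => xA ->.
pattern q; apply: in_ideal_min qB.
  split; [by rewrite mulr0 | split] => [a b Ha Hb|r a Ha].
    by rewrite mulrDr; apply: ID.
  by rewrite mulrCA; apply: IM.
move=> h /mapP [y]; rewrite mem_enum in_setC => yA ->.
by apply/in_ideal_mem/mem_edge_gens; exists x, y; rewrite eA xA (negbTE yA).
Qed.

(** If [kill A f] were 0, then [f * var K y] would lie in the edge ideal, hence so would [var K y];
    but [kill A] does not kill that variable. *)
Lemma nzd_kill_neq0 A f y : (forall x y, e x y = (x \in A) (+) (y \in A)) ->
  y \notin A -> nzd_mod (edge_gens K e) f -> kill A f != 0.
Proof.
move=> eA yA nzd; apply/eqP => fA.
have yB : kill (~: A) (var K y) = 0 by rewrite kill_var in_setC yA.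
have /(kill_edge_ideal eA)/eqP := nzd _ (edge_ideal_mul eA fA yB).
by rewrite kill_var (negbTE yA) (negbTE (var_neq0 _ _)).
Qed.

(* [I] is the intersection of the primes generated by the two sides, whose sum
   is the maximal ideal: splitting [f1 = p + q] accordingly, [p] spans a copy of
   the residue field in the quotient by [(I, f1)], so that the depth is 1. *)
Lemma complete_bipartite_regular_seq_size A fs :
    (forall x y, e x y = (x \in A) (+) (y \in A)) ->
    A != set0 -> ~: A != set0 ->
  regular_seq (edge_gens K e) fs -> (size fs <= 1)%N.
Proof.
move=> eA /set0Pn [xa xaA] /set0Pn [yb]; rewrite in_setC => ybA [fs0 [nzd _]].
have eB x y : e x y = (x \in ~: A) (+) (y \in ~: A).
  by rewrite eA !in_setC; case: (x \in A); case: (y \in A).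
rewrite leqNgt; apply/negP => sz.
have nzd1 := nzd 0%N (ltnW sz); rewrite take0 cats0 in nzd1.
have nzd2 := nzd 1%N sz.
rewrite (take_nth 0) ?take0 /= in nzd2; last exact: ltnW.
have f10 : (nth 0 fs 0)@_0%MM = 0 by apply/fs0/mem_nth/ltnW.
have f20 : (nth 0 fs 1)@_0%MM = 0 by apply/fs0/mem_nth.
move: (nth 0 fs 0) (nth 0 fs 1) nzd1 nzd2 f10 f20 => f1 f2 nzd1 nzd2 f10 f20.
have [I0 [ID IM]] := in_ideal_ideal (edge_gens K e).
pose J p := exists i h, I i /\ p = i + h * f1.
have inJ p : in_ideal (edge_gens K e ++ [:: f1]) p -> J p.
  move=> inI; pattern p; apply: in_ideal_min inI.
    split; [by exists 0, 0; rewrite mul0r addr0|split].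
      move=> _ _ [i [h [Ii ->]]] [j [k [Ij ->]]]; exists (i + j), (h + k).
      by split; [apply: ID | rewrite mulrDl addrACA].
    move=> r _ [i [h [Ii ->]]]; exists (r * i), (r * h).
    by split; [apply: IM | rewrite mulrDr mulrA].
  move=> g; rewrite mem_cat inE => /orP [gI|/eqP ->].
    by exists g, 0; rewrite mul0r addr0; split=> //; apply: in_ideal_mem.
  by exists 0, 1; rewrite mul1r add0r.
have [J0 [JD JM]] := in_ideal_ideal (edge_gens K e ++ [:: f1]).
have IJ p : I p -> in_ideal (edge_gens K e ++ [:: f1]) p.
  move=> inI; pattern p; apply: in_ideal_min inI => [|g gI]; first exact: in_ideal_ideal.
  by apply: in_ideal_mem; rewrite mem_cat gI.
have [p [q [pA qB f1E]]] :
    exists p q, [/\ kill A p = 0, kill (~: A) q = 0 & f1 = p + q].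
  have inI := var_ideal f10; pattern f1; apply: in_ideal_min inI.
    split; [by exists 0, 0; rewrite !rmorph0 addr0 | split].
      move=> _ _ [p [q [pA qB ->]]] [p' [q' [pA' qB' ->]]].
      by exists (p + p'), (q + q'); rewrite !rmorphD /= pA qB pA' qB' !addr0 addrACA.
    move=> r _ [p [q [pA qB ->]]]; exists (r * p), (r * q).
    by rewrite !rmorphM /= pA qB !mulr0 mulrDr.
  move=> g /mapP [x _ ->]; case xA : (x \in A).
    by exists (var K x), 0; rewrite kill_var xA rmorph0 addr0.
  by exists 0, (var K x); rewrite kill_var in_setC xA rmorph0 add0r.
have : in_ideal (edge_gens K e ++ [:: f1]) (f2 * p).
  have inI := var_ideal f20; pattern f2; apply: in_ideal_min inI.
    split; [by rewrite mul0r | split] => [a b Ha Hb|r a Ha].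
      by rewrite mulrDl; apply: JD.
    by rewrite -mulrA; apply: JM.
  move=> g /mapP [x _ ->]; case xA : (x \in A).
    (* For [x] in [A], [x * q] lies in [I], so [x * p] is congruent to [x * f1]; for [x] outside
       [A], [x * p] itself lies in [I]. *)
    have -> : var K x * p = var K x * f1 + (- 1) * (var K x * q).
      by rewrite f1E mulrDr mulN1r addrK.
    apply: JD; first by apply/JM/in_ideal_mem; rewrite mem_cat inE eqxx orbT.
    by apply/JM/IJ/(edge_ideal_mul eA); rewrite ?kill_var ?xA.
  by apply: IJ; rewrite mulrC; apply: (edge_ideal_mul eA); rewrite ?kill_var ?in_setC ?xA.
(* Regularity of [f2] gives [p = i + h * f1] with [i] in [I]. Modulo [A] this forces [h] to vanish,
   modulo [~: A] it forces [h] to be 1. Then [h] and [1 - h] both have constant term 0, which is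
   absurd. *)
move=> /nzd2 /inJ [i [h [Ii pE]]].
have nA := nzd_kill_neq0 eA ybA nzd1.
have nB : kill (~: A) f1 != 0.
  by apply: (nzd_kill_neq0 eB _ nzd1 (y := xa)); rewrite in_setC xaA.
have hA : kill A h = 0.
  move: (congr1 (kill A) pE); rewrite rmorphD rmorphM /= pA (kill_edge_ideal eA Ii) add0r.
  by move/esym/eqP; rewrite mulf_eq0 (negbTE nA) orbF => /eqP.
have hB : kill (~: A) (1 - h) = 0.
  have pB : kill (~: A) p = kill (~: A) f1 by rewrite f1E rmorphD /= qB addr0.
  move: (congr1 (kill (~: A)) pE).
  rewrite rmorphD rmorphM /= pB (kill_edge_ideal eB Ii) add0r -[LHS]mul1r.
  by move/(mulIf nB) => h1; rewrite rmorphB rmorph1 /= -h1 subrr.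
have : (1 : {mpoly K[#|T|]})@_0%MM = 0.
  by rewrite -[1](subrK h) mcoeffD (kill_eq0_coef0 hA) (kill_eq0_coef0 hB) addr0.
by rewrite mcoeff1 eqxx => /eqP; rewrite oner_eq0.
Qed.

(** The prime of [~: A] contains the edge ideal; adjoining two distinct variables from [A] one after
    the other gives two strict inclusions. *)
Lemma complete_bipartite_prime_chain2 A :
    (forall x y, e x y = (x \in A) (+) (y \in A)) -> (1 < #|A|)%N ->
  prime_chain (edge_gens K e) 2.
Proof.
move=> eA /card_gt1P [a [b [aA bA ab]]].
have eB x y : e x y = (x \in ~: A) (+) (y \in ~: A).
  by rewrite eA !in_setC; case: (x \in A); case: (y \in A).
exists (fun i p => kill (nth set0 [:: ~: A; a |: ~: A; b |: (a |: ~: A)] i) p = 0).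
split=> [i i2|].
  split; first exact: kill_prime.
  move=> p /(kill_edge_ideal eB); apply: kill_sub_eq0.
  case: i i2 => [|[|[|]]] //= _; first exact: subsetUr.
  by rewrite setUA subsetUr.
case=> [|[|]] //= _.
  split; first by move=> p; apply/kill_sub_eq0/subsetUr.
  exists (var K a); rewrite !kill_var !inE eqxx aA; split=> //.
  exact/eqP/var_neq0.
split; first by move=> p; apply/kill_sub_eq0/subsetUr.
exists (var K b); rewrite !kill_var !inE eqxx bA eq_sym (negbTE ab); split=> //.
exact/eqP/var_neq0.
Qed.

Lemma complete_bipartite_not_CM A :
    (forall x y, e x y = (x \in A) (+) (y \in A)) ->
    (1 < #|A|)%N -> ~: A != set0 ->
  ~ CM_graph K e.
Proof.
move=> eA cA nA [d [[[fs [sz reg]] _] [_ dmax]]].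
have A0 : A != set0 by rewrite -card_gt0 ltnW.
have := complete_bipartite_regular_seq_size eA A0 nA reg.
by rewrite sz leqNgt (dmax _ (complete_bipartite_prime_chain2 eA cA)).
Qed.

End CompleteBipartite.

(** * Exponents of squarefree monomials *)

Definition set_mnm (T : finType) (C : {set T}) : 'X_{1..#|T|} :=
  [multinom (enum_val i \in C : nat) | i < #|T|].

Lemma set_mnmE (T : finType) (C : {set T}) i :
  set_mnm C i = (enum_val i \in C).
Proof. exact: mnmE. Qed.

Lemma cover_monE (K : fieldType) (T : finType) (C : {set T}) :
  cover_mon K C = 'X_[set_mnm C].
Proof.
rewrite mpolyXE_id (reindex (@enum_rank T)) /=; last first.
  by apply: onW_bij; exact: enum_rank_bij.
rewrite /cover_mon big_mkcond; apply: eq_bigr => x _.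
by rewrite set_mnmE enum_rankK; case: (x \in C); rewrite ?expr1 ?expr0.
Qed.

Lemma mdeg_set_mnm (T : finType) (C : {set T}) : mdeg (set_mnm C) = #|C|.
Proof.
rewrite mdegE (reindex (@enum_rank T)) /=; last first.
  by apply: onW_bij; exact: enum_rank_bij.
rewrite -[RHS]sum1_card [RHS]big_mkcond; apply: eq_bigr => x _.
by rewrite set_mnmE enum_rankK; case: (x \in C).
Qed.

Lemma cover_mon_homog (K : fieldType) (T : finType) (C : {set T}) :
  cover_mon K C \is #|C|.-homog.
Proof. by rewrite cover_monE dhomogX -mdeg_set_mnm. Qed.

(** The union is the exponent of the least common multiple, and [D :\: C] that of the cofactor of
    the monomial of [C]. *)
Lemma set_mnmU (T : finType) (C D : {set T}) :
  (set_mnm (D :\: C) + set_mnm C)%MM = set_mnm (C :|: D).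
Proof.
apply/mnmP => i; rewrite mnmDE !set_mnmE !inE.
by case: (_ \in C); case: (_ \in D).
Qed.

Lemma set_mnmU_le (T : finType) (C D : {set T}) (w : 'X_{1..#|T|}) :
  (set_mnm C <= w)%MM -> (set_mnm D <= w)%MM -> (set_mnm (C :|: D) <= w)%MM.
Proof.
move=> /mnm_lepP Cw /mnm_lepP Dw; apply/mnm_lepP => i.
move: (Cw i) (Dw i); rewrite !set_mnmE !inE.
by case: (_ \in C).
Qed.

Lemma set_mnm_sub_le (T : finType) (C D : {set T}) (w : 'X_{1..#|T|}) :
  C \subset D -> (set_mnm D <= w)%MM -> (set_mnm C <= w)%MM.
Proof.
move=> /subsetP CD /mnm_lepP Dw; apply/mnm_lepP => i.
apply: leq_trans (Dw i); rewrite !set_mnmE.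
by case: (boolP (_ \in C)) => // /CD ->.
Qed.

(** * Exchanges of covers, and spans of families of vectors *)

Definition exchange (T : finType) (C D : {set T}) : bool :=
  (#|C :\: D| == 1)%N && (#|D :\: C| == 1)%N.

(** Confinement to [U] ensures that every cover on a path, and every union of consecutive ones,
    divides each monomial divisible by that of [U]. *)
Definition exchange_in (T : finType) (e : rel T) (U : {set T}) :
    rel {set T} :=
  fun C D => [&& minvcover e C, minvcover e D, C \subset U, D \subset U
                & exchange C D].

Definition in_span (R : nzRingType) (J : finType) (I : Type) (s : J -> I -> R)
    (f : I -> R) : Prop :=
  exists a : J -> R, forall i, f i = \sum_j a j * s j i.

Section Span.
Variables (R : comNzRingType) (J : finType) (I : Type) (s : J -> I -> R).
Implicit Types f g : I -> R.

Lemma in_span_eq f g : f =1 g -> in_span s f -> in_span s g.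
Proof. by move=> fg [a fa]; exists a => i; rewrite -fg. Qed.

Lemma in_span0 : in_span s (fun=> 0).
Proof.
by exists (fun=> 0) => i; rewrite big1 // => j _; rewrite mul0r.
Qed.

Lemma in_spanD f g : in_span s f -> in_span s g ->
  in_span s (fun i => f i + g i).
Proof.
move=> [a fa] [b gb]; exists (fun j => a j + b j) => i.
rewrite fa gb -big_split /=.
by apply: eq_bigr => j _; rewrite mulrDl.
Qed.

Lemma in_spanM c f : in_span s f -> in_span s (fun i => c * f i).
Proof.
move=> [a fa]; exists (fun j => c * a j) => i.
by rewrite fa mulr_sumr; apply: eq_bigr => j _; rewrite mulrA.
Qed.

Lemma in_span_gen j : in_span s (s j).
Proof.
exists (fun k => (k == j)%:R) => i.
rewrite (bigD1 j) //= eqxx mul1r big1 ?addr0 // => k /negbTE ->.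
by rewrite mul0r.
Qed.

Lemma in_span_sum (L : finType) (F : L -> I -> R) :
  (forall l, in_span s (F l)) -> in_span s (fun i => \sum_l F l i).
Proof.
move=> FS; elim: (index_enum L) => [|l r IH].
  by apply: in_span_eq in_span0 => i; rewrite big_nil.
by apply: in_span_eq (in_spanD (FS l) IH) => i; rewrite big_cons.
Qed.

End Span.

(** * Generation of all syzygies by exchanges *)

Section LinearPresentation.
Variables (K : fieldType) (T : finType) (e : rel T).
Local Notation S := {mpoly K[#|T|]}.
Local Notation cover := {C : {set T} | minvcover e C}.

(** This is the reduced syzygy between two monomials. Pairs that are not exchanges give the zero
    vector, so that the index set is simply all pairs. *)
Definition exchange_syz (CD : cover * cover) (E : cover) : S :=
  if exchange (val CD.1) (val CD.2) then
    (E == CD.1)%:R * cover_mon K (val CD.2 :\: val CD.1)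
    - (E == CD.2)%:R * cover_mon K (val CD.1 :\: val CD.2)
  else 0.

Lemma sum_delta (C : cover) (p : S) (u : cover -> S) :
  \sum_E ((E == C)%:R * p) * u E = p * u C.
Proof.
rewrite (bigD1 C) //= eqxx mul1r big1 ?addr0 // => E /negbTE ->.
by rewrite !mul0r.
Qed.

Lemma exchange_syzP CD : \sum_E exchange_syz CD E * cover_mon K (val E) = 0.
Proof.
rewrite /exchange_syz; case: (exchange (val CD.1) (val CD.2)); last first.
  by rewrite big1 // => E _; rewrite mul0r.
under eq_bigr do rewrite mulrBl.
rewrite sumrB !(sum_delta _ _ (fun E => cover_mon K (val E))).
by rewrite !cover_monE -!mpolyXD !set_mnmU setUC subrr.
Qed.

Lemma exchange_syz_homog CD E : exchange_syz CD E \is 1.-homog.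
Proof.
rewrite /exchange_syz /exchange; case: ifP => [/andP [/eqP c1 /eqP c2]|_]; last exact: rpred0.
have h1 := cover_mon_homog K (val CD.1 :\: val CD.2).
have h2 := cover_mon_homog K (val CD.2 :\: val CD.1).
rewrite c1 in h1; rewrite c2 in h2.
by apply: rpredB; rewrite mulr_natl rpredMn.
Qed.

(** The sum telescopes along the path: a step from [C] to [B] contributes its exchange syzygy times
    the monomial of exponent [w - set_mnm (C :|: B)]. Subtraction of exponents is truncated, so this
    union must divide [w]. *)
Lemma exchange_path_span U (C D : cover) (w : 'X_{1..#|T|}) :
  connect (exchange_in e U) (val C) (val D) -> (set_mnm U <= w)%MM ->
  in_span exchange_syz (fun E =>
    (E == C)%:R * 'X_[w - set_mnm (val C)]
    - (E == D)%:R * 'X_[w - set_mnm (val D)]).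
Proof.
move=> /connectP [p pP pD] Uw; elim: p C pP pD => [|B p IH] C /=.
  move=> _ /val_inj ->; apply: in_span_eq (in_span0 _) => E.
  by rewrite subrr.
move=> /andP [/and5P [_ mB CU BU xCB] pP] pD.
pose B' : cover := Sub B mB.
have := in_spanD (in_spanM 'X_[w - set_mnm (val C :|: B)]
  (in_span_gen exchange_syz (C, B'))) (IH B' pP pD).
apply: in_span_eq => E.
have UCB : (set_mnm (val C :|: B) <= w)%MM.
  by apply: set_mnm_sub_le Uw; rewrite subUset CU.
have wE (X Y : {set T}) : (set_mnm (X :|: Y) <= w)%MM ->
   (w - set_mnm (X :|: Y) + set_mnm (Y :\: X))%MM = (w - set_mnm X)%MM.
  by move=> /submK wE; rewrite -[w in RHS]wE -set_mnmU addmA addmK.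
rewrite /exchange_syz /= xCB mulrBr !(mulrCA 'X_[_]) !cover_monE -!mpolyXD.
by rewrite wE // setUC wE 1?setUC // addrA subrK.
Qed.

Lemma connected_syz_span :
    (forall C D, minvcover e C -> minvcover e D ->
       connect (exchange_in e (C :|: D)) C D) ->
  forall f : cover -> S, \sum_C f C * cover_mon K (val C) = 0 ->
  in_span exchange_syz f.
Proof.
move=> conn f syzf.
(* Modulo the exchange syzygies, all ['X_[m] e_C] with [m + set_mnm C = w] agree
   with the chosen representative [phi w]; extending [phi] linearly to [Phi], [f]
   is congruent to [Phi (\sum_C f C * cover_mon C) = Phi 0 = 0]. *)
pose phi (w : 'X_{1..#|T|}) (E : cover) : S :=
  if [pick C : cover | (set_mnm (val C) <= w)%MM] is Some C
  then (E == C)%:R * 'X_[w - set_mnm (val C)] else 0.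
have phiP m C : in_span exchange_syz (fun E =>
    (E == C)%:R * 'X_[m] - phi (m + set_mnm (val C))%MM E).
  rewrite /phi; case: pickP => [D Dw|/(_ C)]; last by rewrite lem_addl.
  have := exchange_path_span (conn _ _ (valP C) (valP D))
     (set_mnmU_le (lem_addl m _) Dw).
  by apply: in_span_eq => E; rewrite addmK.
pose k := \max_C msize (f C).
have fE C : f C = \sum_(m : 'X_{1..#|T| < k}) (f C)@_m *: 'X_[m].
  exact/mpolywE/(leq_bigmax C).
(* The bound loses nothing: monomials of each [f C] have degree below [k], and a cover has at most
   [#|T|] vertices. *)
pose Phi (p : S) (E : cover) : S :=
  \sum_(w : 'X_{1..#|T| < k + #|T|}) p@_w *: phi w E.
have PhiX w E : (mdeg w < k + #|T|)%N -> Phi 'X_[w] E = phi w E.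
  move=> lt_w; rewrite /Phi (bigD1 (BMultinom lt_w)) //= mcoeffX eqxx scale1r.
  rewrite big1 ?addr0 // => v; rewrite -val_eqE /= eq_sym => /negbTE nv.
  by rewrite mcoeffX nv scale0r.
have Phi_sum (L : finType) (F : L -> S) E :
    Phi (\sum_l F l) E = \sum_l Phi (F l) E.
  rewrite /Phi [RHS]exchange_big; apply: eq_bigr => w _ /=.
  by rewrite raddf_sum scaler_suml.
have PhiZ c p E : Phi (c *: p) E = c *: Phi p E.
  by rewrite /Phi scaler_sumr; apply: eq_bigr => w _; rewrite mcoeffZ scalerA.
have phi0 E : \sum_C \sum_(m : 'X_{1..#|T| < k})
    (f C)@_m *: phi (m + set_mnm (val C))%MM E = 0.
  transitivity (Phi (\sum_C f C * cover_mon K (val C)) E); last first.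
    by rewrite syzf /Phi big1 // => w _; rewrite mcoeff0 scale0r.
  rewrite Phi_sum; apply: eq_bigr => C _.
  rewrite [f C in RHS]fE cover_monE mulr_suml Phi_sum; apply: eq_bigr => m _.
  rewrite -scalerAl -mpolyXD PhiZ PhiX // mdegD mdeg_set_mnm -addSn.
  by rewrite leq_add ?max_card // bmdeg.
(* Weighting the relations [phiP] by the coefficients of [f] and summing gives [f] minus the sum
   that [phi0] shows to be 0. *)
have := in_span_sum (fun C => in_span_sum (fun m : 'X_{1..#|T| < k} =>
  in_spanM ((f C)@_m)%:MP (phiP m C))).
apply: in_span_eq => E.
under eq_bigr => C _ do under eq_bigr => m _ do rewrite mul_mpolyC scalerBr.
under eq_bigr => C _ do rewrite sumrB.
rewrite sumrB phi0 subr0 (bigD1 E) //= [X in _ + X]big1 ?addr0; last first.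
  move=> C /negbTE nC; rewrite big1 // => m _.
  by rewrite eq_sym nC mul0r scaler0.
by rewrite [RHS]fE; apply: eq_bigr => m _; rewrite eqxx mul1r.
Qed.

Lemma connected_lin_presented : unmixed e ->
    (forall C D, minvcover e C -> minvcover e D ->
       connect (exchange_in e (C :|: D)) C D) ->
  lin_presented K e.
Proof.
move=> unm conn; split.
  case: (pickP (minvcover e)) => [C mC|noC]; last first.
    by exists 0%N; case=> D mD; move: (noC D); rewrite mD.
  by exists #|C| => -[D mD] /=; rewrite (unm _ _ mC mD) cover_mon_homog.
exists #|{: cover * cover}|, (fun j => exchange_syz (enum_val j)).
split=> [j|]; first exact: exchange_syzP.
split=> [j C|f syzf]; first exact: exchange_syz_homog.
have [a fa] := connected_syz_span conn syzf.
exists (fun j => a (enum_val j)) => C; rewrite fa.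
by rewrite (reindex (@enum_val _ {: cover * cover})) //; apply/onW_bij/enum_val_bij.
Qed.

End LinearPresentation.

(** * Minimal vertex covers and pairs not joined by exchanges *)

Section VertexCovers.
Variables (T : finType) (e : rel T).
Implicit Types C D U V : {set T}.

Lemma vcoverP C :
  reflect (forall x y, e x y -> (x \in C) || (y \in C)) (vcover e C).
Proof.
apply: (iffP forallP) => [cC x y exy|cC x].
  by have /forallP /(_ y) := cC x; rewrite exy.
by apply/forallP => y; apply/implyP => /cC.
Qed.

Lemma connect_exchange_in_sub U V C D : U \subset V ->
  connect (exchange_in e U) C D -> connect (exchange_in e V) C D.
Proof.
move=> sUV; apply: connect_sub => A B /and5P [mA mB AU BU xAB].
by apply: connect1; rewrite /exchange_in mA mB (subset_trans AU) ?(subset_trans BU).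
Qed.

(* If [x] and [y] were not adjacent, some minimal cover [C] inside
   [(C1 :|: C2) :\: [set x; y]] would satisfy [#|C1 :|: C| < #|C1 :|: C2|] and
   [#|C :|: C2| < #|C1 :|: C2|], so that [C1] and [C2] would be connected through [C]. *)
Lemma minimal_disconnected_complete C1 C2 :
    ssrbool.symmetric e -> minvcover e C1 -> minvcover e C2 ->
    ~~ connect (exchange_in e (C1 :|: C2)) C1 C2 ->
    (forall D1 D2, minvcover e D1 -> minvcover e D2 ->
       (#|D1 :|: D2| < #|C1 :|: C2|)%N ->
       connect (exchange_in e (D1 :|: D2)) D1 D2) ->
  forall x y, x \in C1 :\: C2 -> y \in C2 :\: C1 -> e x y.
Proof.
move=> sym m1 m2 nconn conn x y; rewrite !inE => /andP [xC2 xC1] /andP [yC1 yC2].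
apply: contraT => nxy; case/negP: nconn.
have /minsetP [/vcoverP c1 _] := m1; have /minsetP [/vcoverP c2 _] := m2.
set S := (C1 :|: C2) :\: [set x; y].
have in1 z : z \in C1 -> z \notin S -> z = x.
  move=> zC1; rewrite !inE zC1 andbT negbK => /orP [/eqP //|/eqP zy].
  by rewrite zy (negbTE yC1) in zC1.
have in2 z : z \in C2 -> z \notin S -> z = y.
  move=> zC2; rewrite !inE zC2 orbT andbT negbK => /orP [/eqP zx|/eqP //].
  by rewrite zx (negbTE xC2) in zC2.
have cU : vcover e S.
  (* An edge missing [S] meets [C1] only in [x] and [C2] only in [y], so it would join [x] to
     [y]. *)
  apply/vcoverP => u v euv; apply: contraT; rewrite negb_or => /andP [uS vS].
  have xy : x != y by apply: contraNneq xC2 => ->.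
  case/orP: (c1 _ _ euv) => [/in1 /(_ uS) ux|/in1 /(_ vS) vx];
    case/orP: (c2 _ _ euv) => [/in2 /(_ uS) uy|/in2 /(_ vS) vy].
  - by rewrite -ux uy eqxx in xy.
  - by rewrite -ux -vy euv in nxy.
  - by rewrite -vx -uy sym euv in nxy.
  - by rewrite -vx vy eqxx in xy.
have [C mC sC] := minset_exists cU.
have /subsetDP [sCU /disjointFl dC] := sC.
have xC : x \notin C by rewrite dC // !inE eqxx.
have yC : y \notin C by rewrite dC // !inE eqxx orbT.
have s1 : C1 :|: C \subset C1 :|: C2 by rewrite subUset subsetUl.
have s2 : C :|: C2 \subset C1 :|: C2 by rewrite subUset subsetUr sCU.
have l1 : (#|C1 :|: C| < #|C1 :|: C2|)%N.
  apply: proper_card; rewrite properE s1 /=; apply/subsetPn; exists y.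
    by rewrite inE yC2 orbT.
  by rewrite inE negb_or yC1.
have l2 : (#|C :|: C2| < #|C1 :|: C2|)%N.
  apply: proper_card; rewrite properE s2 /=; apply/subsetPn; exists x.
    by rewrite inE xC1.
  by rewrite inE negb_or xC.
apply: connect_trans (connect_exchange_in_sub s1 (conn _ _ m1 mC l1)) _.
exact: connect_exchange_in_sub s2 (conn _ _ mC m2 l2).
Qed.

(** Both sides are covers, and a cover that misses a vertex of [A] contains all of [~: A];
    minimality then gives equality. *)
Lemma complete_bipartite_minvcover (A D : {set T}) :
    (forall x y, e x y = (x \in A) (+) (y \in A)) ->
  minvcover e D -> D = A \/ D = ~: A.
Proof.
move=> eA /minsetP [/vcoverP cD minD].
case: (boolP (A \subset D)) => [AD|/subsetPn [a aA aD]].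
  left; apply/esym/minD => //; apply/vcoverP => x y.
  by rewrite eA; case: (x \in A); case: (y \in A).
right; apply/esym/minD.
  by apply/vcoverP => x y; rewrite eA !inE; case: (x \in A); case: (y \in A).
apply/subsetP => y; rewrite inE => yA.
by have := cD a y; rewrite eA aA (negbTE yA) (negbTE aD); apply.
Qed.

End VertexCovers.

(** * The induced subgraph on the symmetric difference *)

Lemma card_induced_set (T : finType) (L A : {set T}) : A \subset L ->
  #|[set z : {x : T | x \in L} | val z \in A]| = #|A|.
Proof.
move=> AL; rewrite -(card_imset _ val_inj); congr #|pred_of_set _|.
apply/setP => x; apply/imsetP/idP => [[z zA ->]|xA]; first by rewrite inE in zA.
by exists (Sub x (subsetP AL x xA)); rewrite ?inE SubK.
Qed.

Theorem theorem5p12 (K : fieldType) (T : finType) (e : rel T)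
  (e_sym : ssrbool.symmetric e) (e_irr : irreflexive e) :
  unmixed e -> ~ lin_presented K e ->
  exists C1 C2 : {set T},
    [/\ minvcover e C1, minvcover e C2, C1 != C2 &
      let L := (C1 :\: C2) :|: (C2 :\: C1) in
      [/\ unmixed (induced e L), bipartite (induced e L),
          no_isolated (induced e L) & ~ CM_graph K (induced e L)]].
Proof.
move=> unm nlin.
pose bad (CD : {set T} * {set T}) := [&& minvcover e CD.1, minvcover e CD.2
  & ~~ connect (exchange_in e (CD.1 :|: CD.2)) CD.1 CD.2].
have [CD0 bad0] : exists CD, bad CD.
  apply/existsP; apply: contra_notT nlin => /existsPn nbad.
  apply: connected_lin_presented unm _ => C D mC mD.
  by have := nbad (C, D); rewrite /bad /= mC mD /= negbK.
case: (arg_minnP (fun CD => #|CD.1 :|: CD.2|) bad0) => -[C1 C2] /= /and3P [m1 m2 nconn] minC.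
simpl in m1, m2, nconn.
have exy : forall x y, x \in C1 :\: C2 -> y \in C2 :\: C1 -> e x y.
  apply: (minimal_disconnected_complete e_sym m1 m2 nconn) => D1 D2 mD1 mD2.
  apply: contraTT => nc.
  by rewrite -leqNgt (minC (D1, D2)) // /bad /= mD1 mD2.
have cardA : #|C1 :\: C2| = #|C2 :\: C1|.
  apply/eqP; rewrite -(eqn_add2l #|C1 :&: C2|) cardsID setIC cardsID.
  exact/eqP/unm.
have neqC : C1 != C2 by apply: contraNneq nconn => ->; exact: connect0.
(* An empty difference forces [C1 = C2], since the covers have equal size; a single vertex makes the
   pair one exchange, hence connected. *)
have gt1 : (1 < #|C1 :\: C2|)%N.
  case: ltngtP => // [|/esym c1].
    rewrite ltnS leqn0 cards_eq0 setD_eq0 => s12; case/eqP: neqC.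
    by apply/eqP; rewrite eqEcard s12 (unm _ _ m1 m2) leqnn.
  case/negP: nconn; apply: connect1.
  by rewrite /exchange_in m1 m2 subsetUl subsetUr /exchange -cardA c1.
exists C1, C2; split=> //; set L := (C1 :\: C2) :|: (C2 :\: C1).
pose A := [set z : {x : T | x \in L} | val z \in C1 :\: C2].
have cA : #|A| = #|C1 :\: C2| by apply: card_induced_set; exact: subsetUl.
have AC : ~: A = [set z : {x : T | x \in L} | val z \in C2 :\: C1].
  apply/setP => -[z zL]; rewrite !inE /=; move: zL; rewrite !inE.
  by case: (z \in C1); case: (z \in C2).
have cAC : #|~: A| = #|C2 :\: C1|.
  by rewrite AC; apply: card_induced_set; exact: subsetUr.
(* No edge lies inside [A], which the cover [C2] avoids, nor inside [~: A], which [C1] avoids; all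
   edges across are present by [exy]. *)
have eA x y : induced e L x y = (x \in A) (+) (y \in A).
  have /minsetP [/vcoverP c1 _] := m1; have /minsetP [/vcoverP c2 _] := m2.
  have inA z : z \in ~: A -> val z \in C2 :\: C1 by rewrite AC inE.
  rewrite /induced; case: (boolP (x \in A)) => xA; case: (boolP (y \in A)) => yA /=.
  - apply: contraTF isT => /c2; move: xA yA; rewrite !inE.
    by move=> /andP [/negbTE -> _] /andP [/negbTE -> _].
  - by apply: exy; [move: xA; rewrite inE | apply: inA; rewrite inE].
  - by rewrite e_sym; apply: exy; [move: yA; rewrite inE | apply: inA; rewrite inE].
  - rewrite -in_setC in xA; rewrite -in_setC in yA.
    apply: contraTF isT => /c1; move: (inA _ xA) (inA _ yA); rewrite !inE.
    by move=> /andP [/negbTE -> _] /andP [/negbTE -> _].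
have nAC : ~: A != set0 by rewrite -card_gt0 cAC -cardA ltnW.
split.
- move=> D E mD mE.
  have cardD F : minvcover (induced e L) F -> #|F| = #|A|.
    by case/(complete_bipartite_minvcover eA) => ->; rewrite // cAC cA cardA.
  by rewrite !cardD.
- by exists (mem A) => x y; rewrite eA /=; case: (x \in A); case: (y \in A).
- move=> x; case: (boolP (x \in A)) => xA.
    by have /set0Pn [y] := nAC; rewrite inE => yA; exists y; rewrite eA xA (negbTE yA).
  have /card_gt0P [y yA] : (0 < #|A|)%N by rewrite cA ltnW.
  by exists y; rewrite eA (negbTE xA) yA.
- by apply: complete_bipartite_not_CM eA _ nAC; rewrite cA.
Qed.
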